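(* Let $I=[0,1]$ be the bi-pointed metric space with the usual metric, $\bot=0$ and $\top=1$, and let $\iota:I\to M_2\otimes I$ be given by $\iota(x)=l\otimes 2x$ for $x\in[0,\frac12]$ and $\iota(x)=r\otimes(2x-1)$ for $x\in[\frac12,1]$. Then $(I,\iota)$ is not the final co-algebra of $F_2$ on $\mathbf{MS}_2^{L}$.
   Context: A bi-pointed metric space is a set $X$ with two distinguished elements $\top,\bot$ and a metric $d\le 1$ such that $d(\top,\bot)=1$. $\mathbf{MS}_2^{L}$ is the category of bi-pointed metric spaces with Lipschitz maps preserving the distinguished elements. Let $M_2=\{l,r\}$. $M_2\otimes X$ is the quotient of $M_2\times X$ by the equivalence relation generated by $(l,\top)\sim(r,\bot)$, with $\bot_{M_2\otimes X}=l\otimes\bot$, $\top_{M_2\otimes X}=r\otimes\top$, where $m\otimes x$ is the class of $(m,x)$. It carries the metric $d(m\otimes x,m\otimes y)=\frac12 d(x,y)$ and $d(l\otimes x,r\otimes y)=\frac12 d(x,\top)+\frac12 d(\bot,y)$. The endofunctor $F_2$ on $\mathbf{MS}_2^{L}$ is $F_2X=M_2\otimes X$, $(F_2f)(m\otimes x)=(M_2\otimes f)(m\otimes x)=m\otimes f(x)$. An $F_2$ co-algebra is an object $X$ with a morphism $e:X\to M_2\otimes X$; a morphism $(X,e)\to(Y,e')$ is a morphism $f:X\to Y$ with $e'\circ f=(M_2\otimes f)\circ e$; a final co-algebra is a terminal object in the category of co-algebras. *)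

(* Defs.v *)
From HB Require Import structures.
From Stdlib Require Import Relation_Operators.
From mathcomp Require Import all_boot all_order all_algebra generic_quotient.
From mathcomp Require Import lra.
From mathcomp Require Import boolp classical_sets reals topology.

Set Implicit Arguments.
Unset Strict Implicit.
Unset Printing Implicit Defensive.

Import Order.TTheory GRing.Theory Num.Theory.

Local Open Scope ring_scope.
Local Open Scope quotient_scope.

Record bpMetric (R : realType) := BPMetric {
  bp_sort :> metricType R;
  bp_top : bp_sort;
  bp_bot : bp_sort;
  bp_le1 : forall x y : bp_sort, mdist x y <= 1;
  bp_top_bot : mdist bp_top bp_bot = 1 }.

Arguments bp_top {R b}.
Arguments bp_bot {R b}.
Notation "⊤" := bp_top.
Notation "⊥" := bp_bot.

Section Morphisms.
Context {R : realType}.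

Record bpHom (X Y : bpMetric R) := BPHom {
  bp_fun :> X -> Y;
  bp_lipschitz : exists k : R, forall x y, mdist (bp_fun x) (bp_fun y) <= k * mdist x y;
  bp_fun_top : bp_fun ⊤ = ⊤;
  bp_fun_bot : bp_fun ⊥ = ⊥ }.

Lemma bpHom_ext (X Y : bpMetric R) (f g : bpHom X Y) : f =1 g -> f = g.
Proof.
case: f g => [f f1 f2 f3] [g g1 g2 g3] /= /funext fg.
by subst g; congr BPHom; exact: Prop_irrelevance.
Qed.

Program Definition bp_id (X : bpMetric R) : bpHom X X := @BPHom X X id _ _ _.
Next Obligation. by move=> X; exists 1 => x y; rewrite mul1r. Qed.
Next Obligation. by []. Qed.
Next Obligation. by []. Qed.

Program Definition bp_comp (X Y Z : bpMetric R) (g : bpHom Y Z) (f : bpHom X Y) :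
  bpHom X Z := @BPHom X Z (g \o f) _ _ _.
Next Obligation.
move=> X Y Z g f; have [k kP] := bp_lipschitz f; have [h hP] := bp_lipschitz g.
exists (`|h| * k) => x y /=; rewrite -mulrA.
apply: (le_trans (hP _ _)); apply: (@le_trans _ _ (`|h| * mdist (f x) (f y))).
  by rewrite ler_wpM2r ?mdist_ge0 ?ler_norm.
by rewrite ler_wpM2l.
Qed.
Next Obligation. by move=> X Y Z g f /=; rewrite !bp_fun_top. Qed.
Next Obligation. by move=> X Y Z g f /=; rewrite !bp_fun_bot. Qed.

End Morphisms.

Inductive M2 := M2l | M2r.

Definition bool_of_M2 m := if m is M2l then true else false.
Definition M2_of_bool b := if b then M2l else M2r.
Lemma bool_of_M2K : cancel bool_of_M2 M2_of_bool. Proof. by case. Qed.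
HB.instance Definition _ := Choice.copy M2 (can_type bool_of_M2K).

Section Tensor.
Context {R : realType}.
Implicit Types X Y : bpMetric R.

Definition glue X : M2 * X -> M2 * X -> Prop :=
  fun p q => p = (M2l, ⊤) /\ q = (M2r, ⊥).

(* the equivalence relation generated by (l, ⊤) ~ (r, ⊥) *)
Definition glue_rel X : rel (M2 * X) :=
  fun p q => `[< clos_refl_sym_trans _ (@glue X) p q >].

Lemma glue_rel_refl X : reflexive (@glue_rel X).
Proof. by move=> p; apply/asboolP; exact: rst_refl. Qed.

Lemma glue_rel_sym X : symmetric (@glue_rel X).
Proof. by move=> p q; apply/asboolP/asboolP => ?; exact: rst_sym. Qed.

Lemma glue_rel_trans X : transitive (@glue_rel X).
Proof.
by move=> q p s /asboolP pq /asboolP qs; apply/asboolP; exact: rst_trans pq qs.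
Qed.

Definition glue_equiv X :=
  EquivRel (@glue_rel X) (@glue_rel_refl X) (@glue_rel_sym X) (@glue_rel_trans X).

Definition tensor X : Type := {eq_quot glue_equiv X}.
HB.instance Definition _ X := Choice.on (tensor X).
HB.instance Definition _ X := Quotient.on (tensor X).

Definition tens X (m : M2) (x : X) : tensor X := \pi_(tensor X) (m, x).

Lemma tensP X (u : tensor X) : exists m x, u = tens m x.
Proof. by exists (repr u).1, (repr u).2; rewrite /tens -surjective_pairing reprK. Qed.

Lemma tens_glue X : tens M2l (⊤ : X) = tens M2r ⊥.
Proof. by apply/eqmodP/asboolP; exact: rst_step. Qed.

Lemma tensor_liftE X (T : Type) (g : M2 * X -> T) :
  g (M2l, ⊤) = g (M2r, ⊥) ->
  forall p, g (repr (\pi_(tensor X) p)) = g p.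
Proof.
move=> gE p; have /eqmodP/asboolP : repr (\pi_(tensor X) p) = p %[mod tensor X].
  exact: reprK.
move: (repr _) => q.
by elim=> [_ _ [-> ->] //|//|? ? _ //|? ? ? _ -> _ ->].
Qed.

(* Distance on representatives; it is compatible with the gluing by
   tensor_distE, so that the distance on the quotient does not depend on the
   representatives chosen by repr (see mdist_tens_same and mdist_tens_lr). *)
Definition pair_dist X (p q : M2 * X) : R :=
  match p, q with
  | (M2l, x), (M2l, y) | (M2r, x), (M2r, y) => 2^-1 * mdist x y
  | (M2l, x), (M2r, y) => 2^-1 * mdist x ⊤ + 2^-1 * mdist ⊥ y
  | (M2r, x), (M2l, y) => 2^-1 * mdist y ⊤ + 2^-1 * mdist ⊥ x
  end.

Definition tensor_dist X (u v : tensor X) : R := pair_dist (repr u) (repr v).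

Lemma pair_dist_sym X (p q : M2 * X) : pair_dist p q = pair_dist q p.
Proof. by case: p q => [[] x] [[] y] //=; rewrite metric_sym. Qed.

Lemma tensor_distE X (m n : M2) (x y : X) :
  tensor_dist (tens m x) (tens n y) = pair_dist (m, x) (n, y).
Proof.
have glueE (q : M2 * X) : pair_dist (M2l, ⊤) q = pair_dist (M2r, ⊥) q.
  case: q => [[] z] /=; rewrite mdistxx mulr0 ?add0r ?addr0 //.
  by rewrite metric_sym.
rewrite /tensor_dist /tens (tensor_liftE (g := fun p => pair_dist p _)) //.
by rewrite (tensor_liftE (g := pair_dist (m, x))) // ![pair_dist (m, x) _]pair_dist_sym.
Qed.

Lemma tensor_distxx X (u : tensor X) : tensor_dist u u = 0.
Proof.
by have [m [x ->]] := tensP u; rewrite tensor_distE; case: m => /=;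
  rewrite mdistxx mulr0.
Qed.

Lemma tensor_dist_sym X (u v : tensor X) : tensor_dist u v = tensor_dist v u.
Proof. exact: pair_dist_sym. Qed.

Lemma tensor_dist_positivity X (u v : tensor X) : tensor_dist u v = 0 -> u = v.
Proof.
have half x y : 2^-1 * mdist x y = 0 -> x = y :> X.
  by move=> /eqP; rewrite mulf_eq0 invr_eq0 pnatr_eq0 /= => /eqP/mdist_positivity.
have cross (x y : X) : 2^-1 * mdist x ⊤ + 2^-1 * mdist ⊥ y = 0 ->
    tens M2l x = tens M2r y.
  move=> /eqP; rewrite paddr_eq0 ?mulr_ge0 ?invr_ge0 ?mdist_ge0 //.
  by move=> /andP[/eqP/half -> /eqP/half <-]; exact: tens_glue.
have [m [x ->]] := tensP u; have [n [y ->]] := tensP v.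
rewrite tensor_distE; case: m; case: n => /=.
- by move=> /half ->.
- exact: cross.
- by move=> /cross.
- by move=> /half ->.
Qed.

Lemma tensor_dist_triangle X (v u w : tensor X) :
  tensor_dist u w <= tensor_dist u v + tensor_dist v w.
Proof.
have [m [x ->]] := tensP u; have [n [y ->]] := tensP v.
have [o [z ->]] := tensP w; rewrite !tensor_distE.
have tri a b c := @metric_triangle _ X a b c.
have sy a b := @metric_sym _ X a b.
have ge0 a b := @mdist_ge0 _ X a b.
case: m; case: n; case: o => /=.
- by have := tri x y z; lra.
- by have := tri x y ⊤; lra.
- by have := tri x ⊤ z; rewrite (sy z); have := ge0 ⊥ y; lra.
- by have := tri ⊥ y z; lra.
- by have := tri z y ⊤; rewrite (sy y z); lra.
- by have := tri x ⊥ z; rewrite (sy x ⊥); have := ge0 y ⊤; lra.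
- by have := tri ⊥ y x; rewrite (sy y x); lra.
- by have := tri x y z; lra.
Qed.

HB.instance Definition _ X := @isMetric.Build R (tensor X) (@tensor_dist X)
  (@tensor_distxx X) (@tensor_dist_positivity X) (@tensor_dist_sym X)
  (@tensor_dist_triangle X).

Lemma mdist_tens X (m n : M2) (x y : X) :
  mdist (tens m x) (tens n y) = pair_dist (m, x) (n, y).
Proof. exact: tensor_distE. Qed.

Lemma mdist_tens_same X (m : M2) (x y : X) :
  mdist (tens m x) (tens m y) = 2^-1 * mdist x y.
Proof. by rewrite mdist_tens; case: m. Qed.

Lemma mdist_tens_lr X (x y : X) :
  mdist (tens M2l x) (tens M2r y) = 2^-1 * mdist x ⊤ + 2^-1 * mdist ⊥ y.
Proof. exact: mdist_tens. Qed.

Lemma tensor_le1 X (u v : tensor X) : mdist u v <= 1.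
Proof.
have [m [x ->]] := tensP u; have [n [y ->]] := tensP v; rewrite mdist_tens.
have le1 := @bp_le1 _ X.
case: m; case: n => /=.
- by have := le1 x y; lra.
- by have := le1 x ⊤; have := le1 ⊥ y; lra.
- by have := le1 y ⊤; have := le1 ⊥ x; lra.
- by have := le1 x y; lra.
Qed.

Lemma tensor_top_bot X : mdist (tens M2r (⊤ : X)) (tens M2l ⊥) = 1.
Proof.
rewrite metric_sym mdist_tens_lr.
by have := bp_top_bot X; rewrite (metric_sym ⊥) => ->; lra.
Qed.

Definition F2 X : bpMetric R :=
  @BPMetric R (tensor X) (tens M2r ⊤) (tens M2l ⊥) (@tensor_le1 X) (tensor_top_bot X).

(* The class of (m, f x), for (m, x) a representative of u; independent of the
   representative when f preserves ⊤ and ⊥ (tensor_mapE). *)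
Definition tensor_map X Y (f : X -> Y) (u : tensor X) : tensor Y :=
  tens (repr u).1 (f (repr u).2).

Lemma tensor_mapE X Y (f : bpHom X Y) m x :
  tensor_map f (tens m x) = tens m (f x).
Proof.
rewrite /tensor_map /tens.
apply: (tensor_liftE (g := fun p => \pi_(tensor Y) (p.1, f p.2))) => /=.
rewrite bp_fun_top bp_fun_bot; exact: tens_glue.
Qed.

Program Definition F2_map X Y (f : bpHom X Y) : bpHom (F2 X) (F2 Y) :=
  @BPHom R (F2 X) (F2 Y) (tensor_map f) _ _ _.
Next Obligation.
move=> X Y f; have [k kP] := bp_lipschitz f; exists k => u v.
have [m [x ->]] := tensP u; have [n [y ->]] := tensP v.
have := (kP x ⊤, kP ⊥ x, kP y ⊤, kP ⊥ y, kP x y).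
rewrite !tensor_mapE !bp_fun_top !bp_fun_bot !mdist_tens.
by case: m; case: n => /= -[[[[? ?] ?] ?] ?]; lra.
Qed.
Next Obligation. by move=> X Y f; rewrite /= tensor_mapE bp_fun_top. Qed.
Next Obligation. by move=> X Y f; rewrite /= tensor_mapE bp_fun_bot. Qed.

Lemma F2_map_id X : F2_map (bp_id X) = bp_id (F2 X).
Proof.
apply: bpHom_ext => u; have [m [x ->]] := tensP u.
exact: (tensor_mapE (bp_id X)).
Qed.

Lemma F2_map_comp X Y (Z : bpMetric R) (g : bpHom Y Z) (f : bpHom X Y) :
  F2_map (bp_comp g f) = bp_comp (F2_map g) (F2_map f).
Proof.
apply: bpHom_ext => u; have [m [x ->]] := tensP u.
by rewrite [LHS](tensor_mapE (bp_comp g f)) /= !tensor_mapE.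
Qed.

Record coalgebra := Coalgebra {
  coalg_obj : bpMetric R;
  coalg_map : bpHom coalg_obj (F2 coalg_obj) }.

Definition is_coalg_hom (C D : coalgebra) (f : bpHom (coalg_obj C) (coalg_obj D)) :=
  bp_comp (coalg_map D) f = bp_comp (F2_map f) (coalg_map C).

Definition is_final_coalgebra (D : coalgebra) : Prop :=
  forall C : coalgebra,
    exists! f : bpHom (coalg_obj C) (coalg_obj D), is_coalg_hom f.

End Tensor.

Arguments coalgebra R : clear implicits.

Section UnitInterval.
Context {R : realType}.

Definition unitI : Type := {x : R | 0 <= x <= 1}.
HB.instance Definition _ := SubChoice.on unitI.

Lemma unitI_mdistxx (x : unitI) : `|val x - val x| = 0.
Proof. by rewrite subrr normr0. Qed.

Lemma unitI_positivity (x y : unitI) : `|val x - val y| = 0 -> x = y.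
Proof. by move/normr0_eq0/eqP; rewrite subr_eq0 => /eqP/val_inj. Qed.

Lemma unitI_sym (x y : unitI) : `|val x - val y| = `|val y - val x|.
Proof. exact: distrC. Qed.

Lemma unitI_triangle (y x z : unitI) :
  `|val x - val z| <= `|val x - val y| + `|val y - val z|.
Proof. exact: ler_distD. Qed.

HB.instance Definition _ := @isMetric.Build R unitI
  (fun x y => `|val x - val y|)
  unitI_mdistxx unitI_positivity unitI_sym unitI_triangle.

Lemma unitI0_subproof : 0 <= (0 : R) <= 1. Proof. by rewrite lexx ler01. Qed.
Lemma unitI1_subproof : 0 <= (1 : R) <= 1. Proof. by rewrite lexx ler01. Qed.
Definition unitI0 : unitI := exist _ 0 unitI0_subproof.
Definition unitI1 : unitI := exist _ 1 unitI1_subproof.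

Lemma mdist_unitI (x y : unitI) : mdist x y = `|val x - val y|.
Proof. by []. Qed.

Lemma unitI_le1 (x y : unitI) : mdist x y <= 1.
Proof.
rewrite mdist_unitI ler_norml; have := (valP x, valP y).
by move=> [/andP[? ?] /andP[? ?]]; lra.
Qed.

Lemma unitI_top_bot : mdist unitI1 unitI0 = 1.
Proof. by rewrite mdist_unitI /= subr0 normr1. Qed.

Definition I01 : bpMetric R := BPMetric unitI_le1 unitI_top_bot.

Lemma unitI_double_subproof (x : unitI) : val x <= 2^-1 -> 0 <= 2 * val x <= 1.
Proof. by move=> ?; have /andP[? ?] := valP x; lra. Qed.

Lemma unitI_double1_subproof (x : unitI) :
  2^-1 <= val x -> 0 <= 2 * val x - 1 <= 1.
Proof. by move=> ?; have /andP[? ?] := valP x; lra. Qed.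

Definition unitI_double (x : unitI) (h : val x <= 2^-1) : I01 :=
  exist _ (2 * val x) (unitI_double_subproof h).

Definition unitI_double1 (x : unitI) (h : 2^-1 <= val x) : I01 :=
  exist _ (2 * val x - 1) (unitI_double1_subproof h).

(* Both formulas agree at 1/2, where l ⊗ 1 = r ⊗ 0; see iota_l and iota_r. *)
Definition iota_fun (x : I01) : F2 I01 :=
  match lerP (val x) 2^-1 with
  | LerNotGt h => tens M2l (unitI_double h)
  | GtrNotLe h => tens M2r (unitI_double1 (ltW h))
  end.

Lemma iota_l (x : I01) (h : val x <= 2^-1) :
  iota_fun x = tens M2l (unitI_double h).
Proof.
rewrite /iota_fun; case: lerP => h'; first by rewrite (Prop_irrelevance h' h).
by have := lt_le_trans h' h; rewrite ltxx.
Qed.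

Lemma iota_r (x : I01) (h : 2^-1 <= val x) :
  iota_fun x = tens M2r (unitI_double1 h).
Proof.
rewrite /iota_fun; case: lerP => h'; last by congr tens; exact: val_inj.
have xE : val x = 2^-1 by apply: le_anti; rewrite h h'.
have -> : unitI_double h' = ⊤ by apply: val_inj => /=; rewrite xE; lra.
have -> : unitI_double1 h = ⊥ by apply: val_inj => /=; rewrite xE; lra.
exact: tens_glue.
Qed.

Lemma iota_isometry (x y : I01) : mdist (iota_fun x) (iota_fun y) = mdist x y.
Proof.
have lr (a b : I01) (ha : val a <= 2^-1) (hb : 2^-1 <= val b) :
    mdist (iota_fun a) (iota_fun b) = mdist a b.
  rewrite (iota_l ha) (iota_r hb) mdist_tens_lr !mdist_unitI /=.
  move: ha hb (valP a) (valP b) => /= ha hb /andP[? ?] /andP[? ?].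
  by rewrite !ler0_norm; lra.
have [hx|/ltW hx] := lerP (val x) 2^-1; have [hy|/ltW hy] := lerP (val y) 2^-1.
- rewrite !iota_l mdist_tens_same !mdist_unitI /= -mulrBr normrM.
  by rewrite (ger0_norm (ler0n _ 2)) mulKf ?pnatr_eq0.
- exact: lr.
- by rewrite metric_sym lr // metric_sym.
- rewrite !iota_r mdist_tens_same !mdist_unitI /= opprB addrA subrK -mulrBr.
  by rewrite normrM (ger0_norm (ler0n _ 2)) mulKf ?pnatr_eq0.
Qed.

Program Definition iota : bpHom I01 (F2 I01) := @BPHom R I01 (F2 I01) iota_fun _ _ _.
Next Obligation. by exists 1 => x y; rewrite iota_isometry mul1r. Qed.
Next Obligation.
have h : 2^-1 <= val (⊤ : I01) by rewrite /=; lra.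
by rewrite (iota_r h); congr tens; apply: val_inj => /=; lra.
Qed.
Next Obligation.
have h : val (⊥ : I01) <= 2^-1 by rewrite /=; lra.
by rewrite (iota_l h); congr tens; apply: val_inj => /=; rewrite mulr0.
Qed.

Definition I_coalgebra : coalgebra R := Coalgebra iota.

End UnitInterval.

Arguments I_coalgebra R : clear implicits.

(* Main.v *)
Require Import Defs.
From mathcomp Require Import all_boot all_order all_algebra reals.
From mathcomp Require Import topology lra.

(** Lipschitz structure maps may expand by any constant factor, and this is
    incompatible with the fixed expansion rate of [iota].  Precomposing [iota],
    which sends [x] to [l ⊗ 2x] near 0, with the capped doubling
    [x |-> min (2x) 1] gives a second coalgebra on the unit interval,
    [fast_coalgebra], which sends [x] to [l ⊗ 4x] for [x <= 1/4].  A coalgebra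
    morphism [f] from it to [I_coalgebra] must satisfy [f x = f (4x) / 2] for
    such [x] ([hom_quarter]), hence [f (4^-n) = 2^-n] ([hom_invpow4]): near 0 it
    behaves like the square root, which is not Lipschitz.  So no morphism exists,
    and what fails for [I_coalgebra] is the existence half of finality. *)

Set Implicit Arguments.
Unset Strict Implicit.
Unset Printing Implicit Defensive.

Import Order.TTheory GRing.Theory Num.Theory.

Local Open Scope ring_scope.

Section FastCoalgebra.
Context {R : realType}.
Local Notation I := (@I01 R).

Lemma cap_double_subproof (x : I) : 0 <= Num.min (2 * val x) 1 <= 1.
Proof. by have /andP[? ?] := valP x; case: (leP (2 * val x) 1); lra. Qed.

Definition cap_double_fun (x : I) : I :=
  exist _ (Num.min (2 * val x) 1) (cap_double_subproof x).

Lemma cap_double_lipschitz (x y : I) :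
  mdist (cap_double_fun x) (cap_double_fun y) <= 2 * mdist x y.
Proof.
rewrite !mdist_unitI /= ler_norml.
have := ler_norm (val x - val y); have := ler_norm (val y - val x).
rewrite (distrC (val y)); set d := `|_|.
by case: (leP (2 * val x) 1); case: (leP (2 * val y) 1); lra.
Qed.

Lemma cap_double_top : cap_double_fun ⊤ = ⊤.
Proof. by apply: val_inj => /=; case: (leP (2 * 1 : R) 1); lra. Qed.

Lemma cap_double_bot : cap_double_fun ⊥ = ⊥.
Proof. by apply: val_inj => /=; case: (leP (2 * 0 : R) 1); lra. Qed.

Definition cap_double : bpHom I I :=
  @BPHom R I I cap_double_fun (ex_intro _ 2 cap_double_lipschitz)
    cap_double_top cap_double_bot.

Definition fast_coalgebra : coalgebra R := Coalgebra (bp_comp Defs.iota cap_double).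

Lemma iota_fun_inj : injective (@iota_fun R).
Proof.
by move=> x y xy; apply: mdist_positivity; rewrite -iota_isometry xy mdistxx.
Qed.

Lemma iota_fun_eq_l (x z : I) :
  iota_fun x = tens M2l z -> val x = val z / 2.
Proof.
have /andP[z0 z1] := valP z.
have hz : 0 <= val z / 2 <= 1 by lra.
pose y : I := exist _ (val z / 2) hz.
have yE : val y = val z / 2 by [].
have hy : val y <= 2^-1 by rewrite yE; lra.
have -> : tens M2l z = iota_fun y.
  rewrite (iota_l hy); congr tens; apply: val_inj.
  by rewrite [RHS](_ : _ = 2 * val y) // yE; lra.
by move=> /iota_fun_inj ->.
Qed.

(** For [x <= 1/4] the structure map of [fast_coalgebra] is [x |-> l ⊗ 4x], so
    the morphism equation reads [iota (f x) = l ⊗ f (4x)]. *)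
Lemma hom_quarter (f : bpHom I I) (x y : I) :
  @is_coalg_hom R fast_coalgebra (I_coalgebra R) f ->
  val y = 4 * val x -> val (f x) = val (f y) / 2.
Proof.
move=> fhom yx; apply: iota_fun_eq_l; rewrite -tensor_mapE.
have /andP[y0 y1] := valP y.
have capE : val (cap_double x) = 2 * val x.
  by rewrite /=; case: (leP (2 * val x) 1) => //; lra.
have hx : val (cap_double x) <= 2^-1 by rewrite capE; lra.
have -> : y = unitI_double hx.
  apply: val_inj; rewrite [RHS](_ : _ = 2 * val (cap_double x)) // capE; lra.
by rewrite -iota_l; exact: (congr1 (fun g : bpHom I (F2 I) => g x) fhom).
Qed.

Lemma invpow4_subproof n : 0 <= (4 ^- n : R) <= 1.
Proof.
by rewrite invr_ge0 exprn_ge0 //= invf_le1 ?exprn_gt0 // exprn_ege1 ?ler1n.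
Qed.

Definition invpow4 n : I := exist _ (4 ^- n) (invpow4_subproof n).

Lemma hom_invpow4 (f : bpHom I I) n :
  @is_coalg_hom R fast_coalgebra (I_coalgebra R) f -> val (f (invpow4 n)) = 2 ^- n.
Proof.
move=> fhom; elim: n => [|n IHn].
  have -> : invpow4 0 = ⊤ by apply: val_inj; rewrite /= expr0 invr1.
  by rewrite bp_fun_top /= expr0 invr1.
have stepE : val (invpow4 n) = 4 * val (invpow4 n.+1).
  by rewrite /= exprS invfM mulVKf ?pnatr_eq0.
by rewrite (hom_quarter fhom stepE) IHn exprSr invfM.
Qed.

Lemma no_hom_from_fast (f : bpHom I I) :
  ~ @is_coalg_hom R fast_coalgebra (I_coalgebra R) f.
Proof.
move=> fhom; have [k kP] := bp_lipschitz f.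
(* The Lipschitz bound between [4^-n] and 0 reads [2^-n <= k 4^-n]. *)
have pow2_le n : 2 ^+ n <= k.
  have := kP (invpow4 n) ⊥; rewrite !mdist_unitI hom_invpow4 // bp_fun_bot /= !subr0.
  rewrite !ger0_norm ?invr_ge0 ?exprn_ge0 //.
  have -> : 4 = 2 * 2 :> R by rewrite -natrM.
  rewrite exprMn invfM mulrA ler_pdivlMr ?exprn_gt0 //.
  rewrite mulVf ?expf_neq0 ?pnatr_eq0 //.
  by rewrite ler_pdivlMr ?exprn_gt0 // mul1r.
have k0 : 0 <= k by rewrite (le_trans _ (pow2_le 0)) // expr0.
move: (Num.bound k) (archi_boundP k0) => n kn.
have := le_lt_trans (pow2_le n) kn.
by rewrite -natrX ltr_nat ltnNge (ltnW (ltn_expl n (ltnSn 1))).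
Qed.

End FastCoalgebra.

Theorem proposition5 (R : realType) : ~ is_final_coalgebra (I_coalgebra R).
Proof.
by move=> /(_ fast_coalgebra)[f [fhom _]]; exact: no_hom_from_fast fhom.
Qed.
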